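(* Let $N(t)$, $t\ge0$, be a homogeneous Poisson process of rate $\lambda>0$ and let $\alpha>0$. For every $t>0$ and every integer $n\ge0$, $$\mathbb E\left\{\left(\frac1{\Gamma(\alpha)}\int_0^t(t-s)^{\alpha-1}N(s)\,\mathrm ds\right)^2\,\Bigg|\,N(t)=n\right\}=\frac{2n\,t^{2\alpha}\,\Gamma(2\alpha)}{\alpha\,\Gamma^2(\alpha)\,\Gamma(2\alpha+2)}+\frac{n(n-1)\,t^{2\alpha}}{\Gamma^2(\alpha+2)} .$$
   Context: Here $\Gamma^2(x)=(\Gamma(x))^2$. *)

(* Defs.v *)
From HB Require Import structures.
From mathcomp Require Import all_boot all_order all_algebra.
From mathcomp Require Import all_classical all_reals all_analysis.

Set Implicit Arguments.
Unset Strict Implicit.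
Unset Printing Implicit Defensive.

Import Order.TTheory GRing.Theory Num.Theory.
Import numFieldNormedType.Exports.

Local Open Scope classical_set_scope.
Local Open Scope ring_scope.

(* Euler's Gamma function; the integral converges for 0 < a, the only range in
   which it is meaningful here. *)
Definition Gamma {R : realType} (a : R) : R :=
  \int[lebesgue_measure]_(x in `]0, +oo[) (x `^ (a - 1) * expR (- x)).

(* Riemann-Liouville fractional integral of order a of f, based at 0. *)
Definition fractional_integral {R : realType} (a : R) (f : R -> R) (t : R) : R :=
  (Gamma a)^-1 *
    \int[lebesgue_measure]_(s in `[0, t]) ((t - s) `^ (a - 1) * f s).

(* Expectation given an event A of positive probability. *)
Definition cond_expectation {d : measure_display} {T : measurableType d}
    {R : realType} (P : probability T R) (X : T -> R) (A : set T) : \bar R :=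
  ('E_P[X \* \1_A] / P A)%E.

(* The B i range over all measurable sets, including setT, so the product rule
   for the whole family contains the one for each of its subfamilies. *)
Definition mutually_independent {d d' : measure_display}
    {T : measurableType d} {T' : measurableType d'} {R : realType}
    (P : probability T R) (n : nat) (X : 'I_n -> T -> T') : Prop :=
  forall B : 'I_n -> set T', (forall i, measurable (B i)) ->
    P (\bigcap_(i in [set: 'I_n]) X i @^-1` B i) =
    (\prod_(i < n) P (X i @^-1` B i))%E.

Section poisson_process.
Context {d : measure_display} {T : measurableType d} {R : realType}.
Variable P : probability T R.

(* The truncated subtraction of nat is harmless: the paths considered below are
   nondecreasing. *)
Definition increment (N : R -> {RV P >-> nat}) (s t : R) : T -> nat :=
  fun w => (N t w - N s w)%N.

(* Only the restriction of N to times t >= 0 is relevant. *)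
Record is_poisson_process (lambda : R) (N : R -> {RV P >-> nat}) : Prop := {
  poisson_process0 : forall w, N 0 w = 0%N ;
  poisson_process_nondecreasing : forall w s t, 0 <= s -> s <= t ->
    (N s w <= N t w)%N ;
  poisson_process_right_continuous : forall w t, 0 <= t ->
    N u w @[u --> t^'+] --> N t w ;
  poisson_process_independent_increments : forall (n : nat) (t : nat -> R),
    0 <= t 0%N -> (forall i, t i <= t i.+1) ->
    mutually_independent P (fun i : 'I_n => increment N (t i) (t i.+1)) ;
  poisson_process_distribution : forall s t k, 0 <= s -> s < t ->
    P [set w | increment N s t w = k] =
    (poisson_pmf (lambda * (t - s)) k)%:E
}.

End poisson_process.

(* Main.v *)
Require Import Defs.
From mathcomp Require Import all_boot all_order all_algebra.
From mathcomp Require Import all_classical all_reals all_analysis.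
From mathcomp Require Import measurable_realfun ring lra zify.

Import Order.TTheory GRing.Theory Num.Theory.
Import numFieldNormedType.Exports.

Local Open Scope classical_set_scope.
Local Open Scope ring_scope.

(** Write [g s = (t - s) ^ (alpha - 1)], [G u = (t - u) ^ alpha / alpha], so
    that [G u] is the integral of [g] over [[u, t]].  Cut [[0, t]] into [m + 1]
    intervals of equal length [h], with increments [D k] of the process.  Since
    a path is nondecreasing and starts at 0, it lies between the step functions
    that jump by [D k] at the right end, respectively at the left end, of the
    [k]-th interval.  Integrating these against [g] gives, on every path,

      sum_k G ((k + 1) h) * D k <= integral of g * N <= sum_k G (k h) * D k

    ([fractional_integral_bounds]).

    The two outer terms are finite linear combinations of increments, and their
    second moments on the event [N t = n] can be computed exactly: given that
    event, the [n] jump times behave like independent uniform points, whence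

      E [(sum_k c k * D k)^2 | N t = n]
        = n (n - 1) (mean of c)^2 + n (mean of c^2)

    ([integral_sq_sum]).  Instead of constructing these uniform points, one
    computes the second moment of a single increment, which only involves three
    independent Poisson variables ([integral_sq_count]), and polarizes
    ([integral_count_product]).

    As [m] grows, the means of [G] and [G^2] over either grid converge to the
    integral means [t ^ alpha / (alpha (alpha + 1))] and
    [t ^ (2 alpha) / (alpha^2 (2 alpha + 1))] ([cvg_grid_moment_right],
    [cvg_grid_moment_left]), so the conditional second moment is squeezed to

      (n (n - 1) (t ^ alpha / (alpha (alpha + 1)))^2
        + n t ^ (2 alpha) / (alpha^2 (2 alpha + 1))) / Gamma(alpha)^2.

    The recurrence [Gamma (a + 1) = a Gamma a] ([Gamma_rec]) turns this into the
    stated form.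

    All comparisons of integrals are between nonnegative functions and rest on
    [le_integral_ge0], which holds for arbitrary functions. *)

(** * Integrals: monotonicity and the fundamental theorem of calculus *)

(** The integral of a nonnegative function is a supremum over the simple functions
    below it, hence monotone on arbitrary functions.  It compares paths, as
    functions of time, and fractional integrals, as functions of the outcome,
    with step functions and linear combinations of increments. *)
Lemma le_integral_ge0 d (T : measurableType d) (R : realType)
    (mu : {measure set T -> \bar R}) (D : set T) (f g : T -> \bar R) :
  (forall x, D x -> (0 <= f x)%E) -> (forall x, D x -> (f x <= g x)%E) ->
  (\int[mu]_(x in D) f x <= \int[mu]_(x in D) g x)%E.
Proof.
move=> f0 fg.
have g0 x : D x -> (0 <= g x)%E by move=> Dx; exact: le_trans (f0 _ Dx) (fg _ Dx).
rewrite !ge0_integralE//; apply: ereal_sup_le => _ [h hf <-]; exists h => //= x.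
by apply: le_trans (hf x) _; exact: lee_restrict.
Qed.

Section calculus.
Context {R : realType}.
Local Notation mu := (@lebesgue_measure R).

Lemma integral_derivative (f F : R -> R) (a b : R) : a < b ->
  (forall x, a <= x <= b -> is_derive x 1 F (f x)) ->
  (forall x, a <= x <= b -> {for x, continuous f}) ->
  (\int[mu]_(x in `[a, b]) (f x)%:E = (F b - F a)%:E)%E.
Proof.
move=> ab dF cf.
have cF x : a <= x <= b -> {for x, continuous F}.
  move=> /dF dFx; apply: differentiable_continuous; apply/derivable1_diffP.
  by case: dFx.
rewrite (continuous_FTC2 ab (F := F)) ?EFinB//.
- apply: continuous_in_subspaceT => x; rewrite inE/= in_itv/=; exact: cf.
- split.
  + move=> x; rewrite in_itv/= => /andP[ax xb].
    by have [] := dF x; rewrite ?ltW.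
  + by apply: cvg_at_right_filter; apply: cF; rewrite lexx ltW.
  + by apply: cvg_at_left_filter; apply: cF; rewrite lexx ltW.
- move=> x; rewrite in_itv/= => /andP[ax xb].
  by rewrite derive1E; have [|_ ->] := dF x; rewrite ?ltW.
Qed.

Lemma continuous_powR (a x : R) : 0 < x -> {for x, continuous (fun y : R => y `^ a : R)}.
Proof.
move=> x0; apply: differentiable_continuous; apply/derivable1_diffP.
by apply: derivable_powR; rewrite in_itv/= x0.
Qed.

Lemma cvg_invr_natSS : (n.+2%:R^-1 : R) @[n --> \oo] --> (0 : R).
Proof. by have := @cvg_harmonic R; rewrite -cvg_shiftS. Qed.

(** * Euler's Gamma function *)

(** From [y <= exp y] at [y = x / (2 a)], raised to the power [a]: it gives the
    decay at infinity of the Gamma integrand, and its integrability. *)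
Lemma powR_expR_le (a x : R) : 0 < a -> 0 < x ->
  x `^ a * expR (- x) <= (2 * a) `^ a * expR (- (x / 2)).
Proof.
move=> a0 x0.
have a20 : 0 < 2 * a by rewrite mulr_gt0.
have xe : x <= 2 * a * expR (x / (2 * a)).
  rewrite -ler_pdivrMl// mulrC; apply: le_trans (expR_ge1Dx _).
  by rewrite lerDr.
have h : x `^ a <= (2 * a) `^ a * expR (x / (2 * a) * a).
  rewrite expRM -powRM ?expR_ge0 ?(ltW a20)//.
  by apply: ge0_ler_powR => //; rewrite ?nnegrE ?mulr_ge0 ?expR_ge0 ?ltW.
apply: le_trans (ler_wpM2r (expR_ge0 _) h) _.
have -> : x / (2 * a) * a = x / 2 by field; exact: lt0r_neq0.
rewrite -mulrA ler_wpM2l ?powR_ge0// -expRD ler_expR.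
lra.
Qed.

(** Integration by parts: the derivative of [x ^ a * exp (- x)] is the difference
    of the two integrands, and this function vanishes at 0 and at infinity.  The
    identity is proved on [[1 / (n + 2), n + 2]] and passes to the limit by
    monotone convergence.  It holds in the extended reals, so that
    [integral_Gamma_lty] can be deduced from it. *)
Lemma integral_Gamma_rec (a : R) : 0 < a ->
  (\int[mu]_(x in `]0%R, +oo[) (x `^ a * expR (- x))%:E =
   a%:E * \int[mu]_(x in `]0%R, +oo[) (x `^ (a - 1) * expR (- x))%:E)%E.
Proof.
move=> a0.
pose f x := x `^ a * expR (- x); pose g x := x `^ (a - 1) * expR (- x).
pose D n : set R := `[n.+2%:R^-1, n.+2%:R]%classic.
have mpe c : measurable_fun setT (EFin \o (fun x : R => x `^ c * expR (- x))).
  apply/measurable_EFinP; apply: measurable_funM; first exact: measurable_powR.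
  by apply: measurableT_comp => //; exact: measurable_funN.
have D0 n : D n `<=` `]0, +oo[%classic.
  move=> x; rewrite /D/= !in_itv/= andbT => /andP[h _]; apply: lt_le_trans h.
  by rewrite invr_gt0 ltr0n.
have ndD : nondecreasing_seq D.
  move=> m n mn; apply/subsetPset => x; rewrite /D/= !in_itv/= => /andP[mx xm].
  rewrite (le_trans _ mx) ?lef_pV2 ?posrE ?ltr0n ?ler_nat//=.
  by rewrite (le_trans xm)// ler_nat.
have UD : \bigcup_n D n = `]0, +oo[%classic.
  apply/seteqP; split; first by move=> x [n _ /D0].
  move=> x; rewrite /= in_itv/= andbT => x0.
  (* An index that exceeds both [x] and [1 / x]. *)
  pose n := Num.trunc (x + x^-1); exists n => //; rewrite /D/= in_itv/=.
  have xn : x + x^-1 <= n.+2%:R.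
    by apply: ltW; apply: lt_trans (truncnS_gt _) _; rewrite ltr_nat.
  have xi : 0 < x^-1 by rewrite invr_gt0.
  apply/andP; split; last by apply: le_trans xn; rewrite lerDl ltW.
  rewrite -[leRHS]invrK lef_pV2 ?posrE ?ltr0n//.
  by apply: le_trans xn; rewrite lerDr ltW.
have cvgD (h : R -> R) : measurable_fun setT (EFin \o h) -> (forall x, 0 <= h x) ->
    ((\int[mu]_(x in D n) (h x)%:E) @[n --> \oo] -->
     \int[mu]_(x in `]0%R, +oo[) (h x)%:E)%E.
  move=> mh h0; rewrite -UD; apply: ge0_nondecreasing_set_cvg_integral => //=.
  - by move=> n; exact: measurable_itv.
  - by move=> n; apply: measurable_funTS.
  - by move=> n x _; rewrite lee_fin.
have f0 x : 0 <= f x by rewrite mulr_ge0 ?powR_ge0 ?expR_ge0.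
have g0 x : 0 <= a * g x by rewrite !mulr_ge0 ?powR_ge0 ?expR_ge0 ?ltW.
have mag : measurable_fun setT (EFin \o (fun x => a * g x)).
  by apply/measurable_EFinP; apply: measurable_funM => //; apply/measurable_EFinP; exact: mpe.
have cpe c x : 0 < x -> {for x, continuous (fun x : R => x `^ c * expR (- x) : R)}.
  move=> x0; apply: cvgM; first exact: continuous_powR.
  by apply: continuous_comp; [exact: cvgN|exact: continuous_expR].
have cf n : {within D n, continuous f}.
  apply: continuous_in_subspaceT => x /[!inE] /D0/=; rewrite in_itv/= andbT.
  exact: cpe.
have cag x : 0 < x -> {for x, continuous (fun x : R => a * g x : R)}.
  by move=> x0; apply: cvgM; [exact: cvg_cst|exact: cpe].
have cg n : {within D n, continuous (fun x => a * g x)}.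
  apply: continuous_in_subspaceT => x /[!inE] /D0/=; rewrite in_itv/= andbT.
  exact: cag.
have intf n : mu.-integrable (D n) (EFin \o f).
  by apply: continuous_compact_integrable; [exact: segment_compact|exact: cf].
have intg n : mu.-integrable (D n) (EFin \o (fun x => a * g x)).
  by apply: continuous_compact_integrable; [exact: segment_compact|exact: cg].
have key n : (\int[mu]_(x in D n) (f x)%:E =
    \int[mu]_(x in D n) (a * g x)%:E + (f n.+2%:R^-1 - f n.+2%:R)%:E)%E.
  have : (\int[mu]_(x in D n) (a * g x - f x)%:E = (f n.+2%:R - f n.+2%:R^-1)%:E)%E.
    apply: (@integral_derivative (fun x => a * g x - f x) f).
    - rewrite (@lt_trans _ _ 1)// ?invf_lt1 ?ltr1n//.
    - move=> x /andP[nx _].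
      have x0 : 0 < x by apply: lt_le_trans nx.
      have h1 := is_derive1_powR a x0.
      have h2 : is_derive x (1 : R) (fun y : R => expR (- y)) (- expR (- x)).
        by apply: is_derive_eq; rewrite mulrN1.
      have := is_deriveM h1 h2; rewrite /f /g => h3.
      by apply: is_derive_eq h3 _; rewrite /GRing.scale/=; ring.
    - move=> x /andP[nx _]; have x0 : 0 < x by apply: lt_le_trans nx.
      by apply: cvgB; [exact: cag|exact: cpe].
  under eq_integral do rewrite EFinB.
  rewrite integralB_EFin//; last exact: measurable_itv.
  have /fineK <- : (\int[mu]_(x in D n) (a * g x)%:E)%E \is a fin_num.
    by apply: integrable_fin_num (intg n); exact: measurable_itv.
  have /fineK <- : (\int[mu]_(x in D n) (f x)%:E)%E \is a fin_num.
    by apply: integrable_fin_num (intf n); exact: measurable_itv.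
  by rewrite -EFinB -EFinD => -[e]; congr EFin; lra.
have fV0 : f n.+2%:R^-1 @[n --> \oo] --> (0 : R).
  have h0 : (n.+2%:R^-1 : R) `^ a @[n --> \oo] --> (0 : R).
    have /cvg_at_rightP := powR_cvg0 a0; apply; split; last exact: cvg_invr_natSS.
    by move=> n; rewrite invr_gt0 ltr0n.
  apply: squeeze_cvgr h0; last exact: cvg_cst.
  apply: nearW => n; rewrite f0/= -[leRHS]mulr1 ler_wpM2l ?powR_ge0//.
have fn0 : f n.+2%:R @[n --> \oo] --> (0 : R).
  have h0 : (2 * a) `^ a * 2 * (n.+2%:R^-1 : R) @[n --> \oo] --> ((2 * a) `^ a * 2 * 0 : R).
    apply: cvgM; first exact: cvg_cst.
    exact: cvg_invr_natSS.
  rewrite mulr0 in h0; apply: squeeze_cvgr h0; last exact: cvg_cst.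
  apply: nearW => n; rewrite f0/=; apply: le_trans (powR_expR_le _ _ a0 _) _ => //.
  rewrite -mulrA ler_wpM2l ?powR_ge0// expRN.
  rewrite -[2 / _]invrK lef_pV2 ?posrE ?expR_gt0 ?invr_gt0//.
  rewrite invf_div; apply: le_trans (expR_ge1Dx _); by rewrite lerDr.
have cvgf := cvgD f (mpe a) f0.
have cvgg := cvgD _ mag g0.
have cvg0 : (f n.+2%:R^-1 - f n.+2%:R)%:E @[n --> \oo] --> 0%E.
  by apply: cvg_EFin; [exact: nearW|rewrite -[0]subr0; exact: cvgB].
have cvgf' : ((\int[mu]_(x in D n) (f x)%:E) @[n --> \oo] -->
     \int[mu]_(x in `]0%R, +oo[) (a * g x)%:E + 0)%E.
  under eq_fun do rewrite key.
  by apply: cvgeD => //; rewrite fin_num_adde_defl.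
have := @cvg_unique _ (@ereal_hausdorff R) _ _ _ _ cvgf cvgf'.
rewrite adde0 => ->.
under eq_integral do rewrite EFinM.
rewrite ge0_integralZl//=.
- by apply: measurable_funTS; exact: mpe.
- by move=> x _; rewrite lee_fin mulr_ge0 ?powR_ge0 ?expR_ge0.
- by rewrite lee_fin ltW.
Qed.

(** By [integral_Gamma_rec] it suffices to bound the integral with exponent [a] in
    place of [a - 1]: it has no singularity at 0, and [powR_expR_le] dominates the
    integrand by a multiple of the exponential density of rate [1 / 2]. *)
Lemma integral_Gamma_lty (a : R) : 0 < a ->
  (\int[mu]_(x in `]0%R, +oo[) (x `^ (a - 1) * expR (- x))%:E < +oo)%E.
Proof.
move=> a0.
suff : (\int[mu]_(x in `]0%R, +oo[) (x `^ a * expR (- x))%:E < +oo)%E.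
  rewrite integral_Gamma_rec//; case: integral => [r| |]; rewrite ?ltry ?ltNyr//.
  by rewrite gt0_muley ?lte_fin.
pose C : R := (2 * a) `^ a * 2.
have C0 : 0 <= C by rewrite mulr_ge0 ?powR_ge0.
apply: (@le_lt_trans _ _ (\int[mu]_x (C%:E * (exponential_pdf 2^-1 x)%:E))%E).
  rewrite integral_mkcond; apply: le_integral_ge0 => x _.
    by apply: erestrict_ge0 => y _; rewrite lee_fin mulr_ge0 ?powR_ge0 ?expR_ge0.
  rewrite patchE; case: ifPn => [|_]; last first.
    by rewrite -EFinM lee_fin mulr_ge0// exponential_pdf_ge0.
  rewrite inE/= in_itv/= andbT => x0.
  rewrite -EFinM lee_fin; apply: le_trans (powR_expR_le _ _ a0 x0) _.
  rewrite exponential_pdfE; last exact: ltW.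
  rewrite /C -mulrA mulVKf// mulNr.
  by rewrite [x / 2]mulrC.
rewrite ge0_integralZl//=.
- by rewrite integral_exponential_pdf// mule1 ltry.
- by apply/measurable_EFinP; exact: measurable_exponential_pdf.
- by move=> x _; rewrite lee_fin exponential_pdf_ge0.
Qed.

Lemma Gamma_rec (a : R) : 0 < a -> Gamma (a + 1) = a * Gamma a.
Proof.
move=> a0; rewrite /Gamma /Rintegral addrK integral_Gamma_rec// fineM//.
rewrite ge0_fin_numE; first exact: integral_Gamma_lty.
by apply: integral_ge0 => x _; rewrite lee_fin mulr_ge0 ?powR_ge0 ?expR_ge0.
Qed.

(** By the recurrence one may replace [a] by [a + 1]; then the integrand is at least
    [exp (- 2)] on [[1, 2]]. *)
Lemma Gamma_gt0 (a : R) : 0 < a -> 0 < Gamma a.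
Proof.
move=> a0; rewrite -(pmulr_rgt0 _ a0) -Gamma_rec//.
have : ((expR (- 2))%:E <= \int[mu]_(x in `]0%R, +oo[) (x `^ a * expR (- x))%:E)%E.
  have -> : ((expR (- 2 : R))%:E = \int[mu]_(x in `[1%R, 2%R]) (cst (expR (- 2))%:E) x)%E.
    rewrite integral_cst//= lebesgue_measure_itv/= lte_fin ltr1n -EFinB.
    by rewrite -EFinM; congr EFin; ring.
  rewrite integral_mkcond [leRHS]integral_mkcond; apply: le_integral_ge0 => x _.
    by apply: erestrict_ge0 => y _; rewrite lee_fin expR_ge0.
  rewrite !patchE; case: ifPn => [|_]; last first.
    by case: ifP => // _; rewrite lee_fin mulr_ge0 ?powR_ge0 ?expR_ge0.
  rewrite inE/= in_itv/= => /andP[x1 x2].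
  rewrite ifT ?inE/= ?in_itv/= ?andbT ?(lt_le_trans ltr01 x1)//.
  rewrite lee_fin -[leLHS]mul1r ler_pM ?expR_ge0 ?ler_expR ?lerN2//.
  by rewrite -(powRr0 x) ler_powR// ltW.
rewrite /Gamma /Rintegral addrK.
have a10 : 0 < a + 1 by rewrite addr_gt0.
have := integral_Gamma_lty _ a10; rewrite addrK.
case: integral => //= r _; rewrite lee_fin; apply: lt_le_trans; exact: expR_gt0.
Qed.

(** The integrand may be singular at [t]: the fundamental theorem of calculus is
    applied on [[u, t - (t - u) / (n + 2)]], followed by monotone convergence. *)
Lemma integral_subr_powR (a u t : R) : 0 < a -> u <= t ->
  (\int[mu]_(s in `[u, t]) ((t - s) `^ (a - 1))%:E = ((t - u) `^ a / a)%:E)%E.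
Proof.
move=> a0; rewrite le_eqVlt => /predU1P[->|ut].
  by rewrite set_itv1 integral_set1 subrr powR0 ?gt_eqF// mul0r.
pose v n : R := t - (t - u) / n.+2%:R.
pose D n := `[u, v n]%classic.
have tu0 : 0 < t - u by rewrite subr_gt0.
have vt n : v n < t by rewrite /v ltrBlDr ltrDl divr_gt0.
have uv n : u < v n.
  rewrite /v ltrBrDr -ltrBrDl ltr_pdivrMr// ltr_pMr// ltr1n//.
have ndD : nondecreasing_seq D.
  move=> m n mn; apply/subsetPset => x; rewrite /D/= !in_itv/= => /andP[-> xm]/=.
  rewrite (le_trans xm)// /v lerB// ler_wpM2l ?(ltW tu0)// lef_pV2 ?posrE ?ltr0n//.
  by rewrite ler_nat.
have UD : \bigcup_n D n = `[u, t[%classic.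
  apply/seteqP; split => [x [n _]|x]; rewrite /D/= !in_itv/= => /andP[ux xt].
    by rewrite ux (le_lt_trans xt).
  have tx0 : 0 < t - x by rewrite subr_gt0.
  pose n := Num.trunc ((t - u) / (t - x)); exists n => //=; rewrite in_itv/= ux /v/=.
  rewrite lerBrDr -lerBrDl ler_pdivrMr// mulrC -ler_pdivrMr//.
  by apply: ltW; apply: lt_trans (truncnS_gt _) _; rewrite ltr_nat.
pose f (s : R) : R := (t - s) `^ (a - 1).
have mf : measurable_fun setT (EFin \o f).
  apply/measurable_EFinP; rewrite /f.
  apply: (measurableT_comp (measurable_powR _)); exact: measurable_funB.
rewrite -integral_itv_bndo_bndc; last exact: measurable_funTS.
have cv : ((\int[mu]_(x in D n) (f x)%:E) @[n --> \oo] -->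
    \int[mu]_(x in `[u, t[) (f x)%:E)%E.
  rewrite -UD; apply: ge0_nondecreasing_set_cvg_integral => //=.
  - by move=> n; exact: measurable_itv.
  - by move=> n; exact: measurable_funTS.
  - by move=> n x _; rewrite lee_fin powR_ge0.
have val n : (\int[mu]_(x in D n) (f x)%:E =
    ((t - u) `^ a / a - (t - v n) `^ a / a)%:E)%E.
  pose F (s : R) : R := - ((t - s) `^ a / a).
  apply: etrans (integral_derivative f F _ _ (uv n) _ _) _; last first.
  - by rewrite /F; congr EFin; ring.
  - move=> x /andP[_ xv]; have tx : 0 < t - x by rewrite subr_gt0 (le_lt_trans xv).
    apply: (@continuous_comp _ _ _ (fun s => t - s) (fun y => y `^ (a - 1))).
      by apply: cvgB; [exact: cvg_cst|exact: cvg_id].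
    exact: continuous_powR.
  - move=> x /andP[_ xv]; have tx : 0 < t - x by rewrite subr_gt0 (le_lt_trans xv).
    have h1 := is_derive1_powR a tx.
    have h2 : is_derive x (1 : R) (fun y : R => t - y) (- 1).
      by apply: is_derive_eq; rewrite add0r mul1r.
    have h3 := @is_derive1_comp R (fun y : R => y `^ a) (fun y : R => t - y) _ _ _ h1 h2.
    have -> : F = (- a^-1) \*: ((fun y : R => y `^ a) \o (fun y : R => t - y)).
      by apply/funext => s; rewrite /F mulrC -mulNr.
    apply: is_derive_eq; rewrite /GRing.scale/= /f; field; exact: lt0r_neq0.
have cv2 : (((t - u) `^ a / a - (t - v n) `^ a / a)%:E @[n --> \oo] -->
    ((t - u) `^ a / a - 0 / a)%:E)%E.
  apply: cvg_EFin; first exact: nearW.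
  apply: cvgB; first exact: cvg_cst.
  apply: cvgM; last exact: cvg_cst.
  have /cvg_at_rightP := powR_cvg0 a0; apply; split.
    by move=> n; rewrite subr_gt0.
  rewrite /v; under eq_fun do rewrite opprB addrCA subrr addr0.
  have h : (t - u) * (n.+2%:R^-1 : R) @[n --> \oo] --> (t - u) * 0.
    by apply: cvgM; [exact: cvg_cst|exact: cvg_invr_natSS].
  by rewrite mulr0 in h.
move: cv; under eq_fun do rewrite val.
move=> cv; have := @cvg_unique _ (@ereal_hausdorff R) _ _ _ _ cv cv2.
by rewrite mul0r subr0; exact.
Qed.

(** * Riemann sums of power functions *)

(** Mean value theorem for [y ^ (b + 1)] on [[k, k + 1]]; the derivative formula
    holds for positive arguments, so the case [k = 0] is checked directly. *)
Lemma powR_increment (b : R) (k : nat) : 0 < b ->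
  (b + 1) * k%:R `^ b <= k.+1%:R `^ (b + 1) - k%:R `^ (b + 1)
    <= (b + 1) * k.+1%:R `^ b.
Proof.
move=> b0; have b10 : 0 < b + 1 by rewrite addr_gt0.
case: k => [|k].
  rewrite !powR0 ?gt_eqF// powR1 mulr0 subr0 ler01/=.
  by rewrite mulr1 lerDr ltW.
have k0 : 0 < k.+1%:R :> R by rewrite ltr0n.
have kk : k.+1%:R <= k.+2%:R :> R by rewrite ler_nat.
have [x||x xk kx] := @MVT_segment R (fun y => y `^ (b + 1))
    (fun y => (b + 1) * y `^ b) k.+1%:R k.+2%:R kk.
- rewrite in_itv/= => /andP[kx _].
  by have := is_derive1_powR (b + 1) (lt_trans k0 kx); rewrite addrK.
- apply: continuous_in_subspaceT => y; rewrite inE/= in_itv/= => /andP[ky _].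
  by apply: continuous_powR; exact: lt_le_trans ky.
- move: xk; rewrite in_itv/= => /andP[kx' xk]; rewrite kx.
  have -> : k.+2%:R - k.+1%:R = 1 :> R by rewrite -natrB// subSnn.
  have x0 := lt_le_trans k0 kx'.
  rewrite mulr1 !ler_wpM2l ?(ltW b10)//.
  + by apply: ge0_ler_powR; rewrite ?nnegrE// ltW.
  + by apply: ge0_ler_powR; rewrite ?nnegrE// ltW.
Qed.

Lemma sum_powR_bounds (b : R) (m : nat) : 0 < b ->
  (b + 1) * \sum_(k < m) k%:R `^ b <= m%:R `^ (b + 1)
    <= (b + 1) * \sum_(k < m) k.+1%:R `^ b.
Proof.
move=> b0; elim: m => [|m /andP[IHl IHr]].
  by rewrite !big_ord0 mulr0 powR0 ?lexx// gt_eqF// addr_gt0.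
have /andP[hl hr] := powR_increment b m b0.
by rewrite !big_ord_recr/= !mulrDr; apply/andP; split; lra.
Qed.

(** Means of [y ^ b] over the right, respectively left, ends of the cells of
    [[0, 1]]; the cells are indexed by [x = 1 - y] because the time [s] enters
    the kernel through [1 - s / t]. *)
Definition mean_powR_right (b : R) (m : nat) : R :=
  (\sum_(k < m.+1) (1 - k%:R / m.+1%:R) `^ b) / m.+1%:R.

Definition mean_powR_left (b : R) (m : nat) : R :=
  (\sum_(k < m.+1) (1 - k.+1%:R / m.+1%:R) `^ b) / m.+1%:R.

Lemma mean_powR_bounds (b : R) (m : nat) : 0 < b ->
  [/\ (b + 1)^-1 <= mean_powR_right b m, mean_powR_left b m <= (b + 1)^-1
    & mean_powR_right b m = mean_powR_left b m + m.+1%:R^-1].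
Proof.
move=> b0; have b10 : 0 < b + 1 by rewrite addr_gt0.
have m0 : 0 < m.+1%:R :> R by rewrite ltr0n.
have p0 c : 0 < m.+1%:R `^ c :> R by rewrite powR_gt0.
have pD : m.+1%:R `^ (b + 1) = m.+1%:R `^ b * m.+1%:R :> R.
  by rewrite powRD ?powRr1 ?ltW// (gt_eqF m0) implybT.
have eR : mean_powR_right b m = (\sum_(k < m.+1) k.+1%:R `^ b) / m.+1%:R `^ (b + 1).
  rewrite /mean_powR_right pD invfM mulrA; congr (_ / _).
  rewrite (reindex_inj rev_ord_inj)/= mulr_suml; apply: eq_bigr => k _.
  have km : (k <= m)%N by rewrite -ltnS.
  rewrite subSS natrB//.
  have -> : 1 - (m%:R - k%:R) / m.+1%:R = k.+1%:R * m.+1%:R^-1 :> R.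
    by rewrite -!natr1; field; rewrite natr1 gt_eqF.
  by rewrite powRM ?invr_ge0 ?ler0n// -powR_inv1 ?ler0n// -powRrM mulN1r powRN.
have eL : mean_powR_left b m = (\sum_(k < m.+1) k%:R `^ b) / m.+1%:R `^ (b + 1).
  rewrite /mean_powR_left pD invfM mulrA; congr (_ / _).
  rewrite (reindex_inj rev_ord_inj)/= mulr_suml; apply: eq_bigr => k _.
  have km : (k <= m)%N by rewrite -ltnS.
  rewrite subSS -subSn// natrB; last exact: leqW.
  have -> : 1 - (m.+1%:R - k%:R) / m.+1%:R = k%:R * m.+1%:R^-1 :> R.
    by field; rewrite gt_eqF.
  by rewrite powRM ?invr_ge0 ?ler0n// -powR_inv1 ?ler0n// -powRrM mulN1r powRN.
have /andP[hl hr] := sum_powR_bounds b m.+1 b0.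
split.
- by rewrite eR ler_pdivlMr// ler_pdivrMl.
- by rewrite eL ler_pdivrMr// ler_pdivlMl.
- rewrite eR eL big_ord_recr/= big_ord_recl/= powR0 ?gt_eqF// add0r mulrDl.
  by congr (_ + _); rewrite pD invfM mulVKf// gt_eqF.
Qed.

Lemma cvg_mean_powR_right (b : R) : 0 < b ->
  mean_powR_right b m @[m --> \oo] --> (b + 1)^-1.
Proof.
move=> b0.
have h : (b + 1)^-1 + (m.+1%:R^-1 : R) @[m --> \oo] --> (b + 1)^-1 + 0.
  by apply: cvgD; [exact: cvg_cst|exact: cvg_harmonic].
rewrite addr0 in h; apply: squeeze_cvgr (cvg_cst _) h.
apply: nearW => m; have [-> h2 ->] := mean_powR_bounds b m b0.
by rewrite lerD2r.
Qed.

Lemma cvg_mean_powR_left (b : R) : 0 < b ->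
  mean_powR_left b m @[m --> \oo] --> (b + 1)^-1.
Proof.
move=> b0.
have h : (b + 1)^-1 - (m.+1%:R^-1 : R) @[m --> \oo] --> (b + 1)^-1 - 0.
  by apply: cvgB; [exact: cvg_cst|exact: cvg_harmonic].
rewrite subr0 in h; apply: squeeze_cvgr h (cvg_cst _).
apply: nearW => m; have [h1 -> h2] := mean_powR_bounds b m b0.
by rewrite lerBlDr -h2 h1.
Qed.

End calculus.

(** * Moments of Poisson weights *)

Section poisson_weight.
Context {R : realType}.
Implicit Types (x y : R) (n k : nat).

(** Unlike [poisson_pmf], this is the point mass at 0 when the rate is 0, which is
    the law of an increment over an interval of length 0. *)
Definition poisson_weight x k : R := x ^+ k / k`!%:R * expR (- x).

Lemma factr_neq0 k : k`!%:R != 0 :> R.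
Proof. by rewrite pnatr_eq0 -lt0n fact_gt0. Qed.

Lemma poisson_weight_gt0 x k : 0 < x -> 0 < poisson_weight x k.
Proof.
by move=> x0; rewrite !mulr_gt0 ?expR_gt0 ?exprn_gt0// invr_gt0 ltr0n fact_gt0.
Qed.

Lemma poisson_weight0 k : poisson_weight 0 k = (k == 0)%:R.
Proof.
rewrite /poisson_weight oppr0 expR0 mulr1; case: k => [|k].
  by rewrite expr0 fact0 divr1.
by rewrite exprS !mul0r.
Qed.

Lemma poisson_weightS x k :
  k.+1%:R * poisson_weight x k.+1 = x * poisson_weight x k.
Proof.
rewrite /poisson_weight factS natrM exprS; field.
by rewrite factr_neq0 nat1r pnatr_eq0.
Qed.

Lemma poisson_convolution x y n :
  \sum_(k < n.+1) poisson_weight x k * poisson_weight y (n - k) =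
  poisson_weight (x + y) n.
Proof.
rewrite /poisson_weight addrC exprDn !mulr_suml; apply: eq_bigr => k _.
have kn : (k <= n)%N by rewrite -ltnS.
have -> : n`!%:R = 'C(n, k)%:R * k`!%:R * (n - k)`!%:R :> R.
  by rewrite -!natrM -mulnA bin_fact.
rewrite -mulr_natr opprD expRD; field.
by rewrite !factr_neq0 pnatr_eq0 -lt0n bin_gt0.
Qed.

Lemma poisson_moment1 x y n :
  \sum_(k < n.+2) k%:R * (poisson_weight x k * poisson_weight y (n.+1 - k)) =
  x * poisson_weight (x + y) n.
Proof.
rewrite big_ord_recl mul0r add0r -poisson_convolution mulr_sumr.
by apply: eq_bigr => k _; rewrite /= subSS mulrA poisson_weightS mulrA.
Qed.

(** Dividing by [poisson_weight (x + y) n] gives the second moment of the binomial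
    distribution with [n] trials and success probability [x / (x + y)]. *)
Lemma poisson_moment2 x y n : x + y != 0 ->
  \sum_(k < n.+1) k%:R ^+ 2 * (poisson_weight x k * poisson_weight y (n - k)) =
  poisson_weight (x + y) n *
    (n%:R * (n%:R - 1) * (x / (x + y)) ^+ 2 + n%:R * (x / (x + y))).
Proof.
move=> xy0; case: n => [|n]; first by rewrite big_ord1 !expr2 !mul0r addr0 mulr0.
have -> : \sum_(k < n.+2) k%:R ^+ 2 *
      (poisson_weight x k * poisson_weight y (n.+1 - k)) =
    x * (\sum_(k < n.+1) k%:R * (poisson_weight x k * poisson_weight y (n - k))
         + poisson_weight (x + y) n).
  rewrite big_ord_recl expr2 !mul0r add0r -poisson_convolution -big_split/=.
  rewrite mulr_sumr; apply: eq_bigr => k _; rewrite subSS expr2.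
  rewrite -[LHS]mulrA [X in _ * X]mulrA poisson_weightS -natr1; ring.
have e1 : poisson_weight (x + y) n = n.+1%:R * poisson_weight (x + y) n.+1 / (x + y).
  by rewrite poisson_weightS mulrC mulKf.
case: n e1 => [|n] e1.
  rewrite big_ord1 mul0r add0r e1; field; exact: xy0.
rewrite poisson_moment1 e1.
have -> : poisson_weight (x + y) n = n.+1%:R * poisson_weight (x + y) n.+1 / (x + y).
  by rewrite poisson_weightS mulrC mulKf.
rewrite e1 -!natr1; field; exact: xy0.
Qed.

End poisson_weight.

(** * Second moments of increments given the final count *)

Section poisson_process.
Context {d : measure_display} {T : measurableType d} {R : realType}.
Variables (P : probability T R) (lambda : R) (N : R -> {RV P >-> nat}).
Hypotheses (lambda_gt0 : 0 < lambda) (NP : is_poisson_process lambda N).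

Lemma measurable_increment s t : measurable_fun setT (increment N s t).
Proof. exact: measurable_fun_subn. Qed.

Lemma measurable_increment_eq s t k : measurable [set w | increment N s t w = k].
Proof.
rewrite -[X in measurable X]setTI.
exact: (measurable_increment s t measurableT [set k]).
Qed.

Lemma increment_law (s t : R) (k : nat) : 0 <= s -> s <= t ->
  P [set w | increment N s t w = k] = (poisson_weight (lambda * (t - s)) k)%:E.
Proof.
move=> s0; rewrite le_eqVlt => /predU1P[<-|st].
  rewrite subrr mulr0 poisson_weight0 /increment.
  have [->|k0] := eqVneq k 0%N.
    rewrite (_ : [set w | _] = setT) ?probability_setT//.
    by apply/seteqP; split => // w _ /=; rewrite subnn.
  rewrite (_ : [set w | _] = set0) ?measure0//.
  by apply/seteqP; split => // w /=; rewrite subnn => e; rewrite -e eqxx in k0.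
rewrite (poisson_process_distribution NP)// /poisson_pmf.
by rewrite mulr_gt0 ?subr_gt0.
Qed.

Lemma increment3_law (s u t : R) (a b c : nat) : 0 <= s -> s <= u -> u <= t ->
  P [set w | [/\ increment N 0 s w = a, increment N s u w = b
                & increment N u t w = c]] =
  (poisson_weight (lambda * s) a * poisson_weight (lambda * (u - s)) b *
   poisson_weight (lambda * (t - u)) c)%:E.
Proof.
move=> s0 su ut.
pose times i := nth t [:: 0; s; u] i.
have := @poisson_process_independent_increments _ _ _ _ _ _ NP 3%N times (lexx 0).
have mono i : times i <= times i.+1 by case: i => [|[|[|i]]] //=; rewrite /times !nth_default.
move=> /(_ mono) => indep.
have := indep (fun i : 'I_3 => [set nth c [:: a; b] i]) (fun i => I).
rewrite !big_ord_recl big_ord0 mule1 /times/= /preimage/=.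
rewrite -[X in poisson_weight (lambda * X) a](subr0 s).
rewrite EFinM (EFinM (poisson_weight _ _)) -!increment_law ?(le_trans s0 su)//.
rewrite muleA => <-.
congr (P _); apply/seteqP; split => w.
  by move=> [ha hb hc] [[|[|[|i]]]//= ilt] _.
move=> h; split.
- exact: (h ord0 I).
- exact: (h (lift ord0 ord0) I).
- exact: (h (lift ord0 (lift ord0 ord0)) I).
Qed.

Lemma poisson_process_law (t : R) (k : nat) : 0 <= t ->
  P [set w | N t w = k] = (poisson_weight (lambda * t) k)%:E.
Proof.
move=> t0; rewrite -[t in RHS]subr0 -increment_law//; congr (P _).
by apply/seteqP; split => w; rewrite /= /increment (poisson_process0 NP) subn0.
Qed.

Local Notation level t n := [set w | N t w = n].

Lemma measurable_level t n : measurable (level t n).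
Proof. by apply: (@measurable_funPTI _ _ _ _ (N t) [set n]). Qed.

Lemma measurable_count (s : R) : measurable_fun setT (fun w => (N s w)%:R : R).
Proof. exact: (@measurableT_comp _ _ _ _ _ _ (fun k : nat => k%:R : R)). Qed.

Lemma count_le (s t : R) n w : 0 <= s -> s <= t -> level t n w -> (N s w <= n)%N.
Proof. by move=> s0 st <-; exact: poisson_process_nondecreasing NP _ _ _ s0 st. Qed.

(** On the event [N t = n], the three increments over [[0, s]], [[s, u]], [[u, t]]
    are some [a], [b], [n - b - a]; summing over [a] the first and the last one
    merge by [poisson_convolution] into a Poisson variable for the total length
    [t - (u - s)]. *)
Lemma integral_sq_increment (s u t : R) n : 0 <= s -> s <= u -> u <= t ->
  (\int[P]_(w in level t n) (((N u w)%:R - (N s w)%:R) ^+ 2)%:E =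
   (\sum_(b < n.+1) b%:R ^+ 2 * (poisson_weight (lambda * (u - s)) b *
      poisson_weight (lambda * (t - (u - s))) (n - b)))%:E)%E.
Proof.
move=> s0 su ut; have st := le_trans su ut; have u0 := le_trans s0 su.
pose E (b a : nat) := [set w | [/\ increment N 0 s w = a, increment N s u w = b
                & increment N u t w = (n - b - a)%N]].
have mE b a : measurable (E b a).
  rewrite (_ : E b a = [set w | increment N 0 s w = a] `&`
    [set w | increment N s u w = b] `&` [set w | increment N u t w = (n - b - a)%N]).
    by do 2?apply: measurableI; exact: measurable_increment_eq.
  by apply/seteqP; split => [w []//|w [[]]//].
pose f (b : 'I_n.+1) (w : T) : \bar R :=
  (\sum_(a < (n - b).+1) (b%:R ^+ 2 * \1_(E b a) w)%:E)%E.
have mono r v w : 0 <= r -> r <= v -> (N r w <= N v w)%N.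
  by move=> r0 rv; exact: poisson_process_nondecreasing NP _ _ _ r0 rv.
transitivity (\int[P]_(w in level t n) (\sum_(b < n.+1) f b w))%E.
  apply: eq_integral => w /[!inE] /= Ntn.
  have su' := mono s u w s0 su; have ut' := mono u t w u0 ut.
  rewrite Ntn in ut'.
  have bn : (N u w - N s w < n.+1)%N by rewrite ltnS (leq_trans (leq_subr _ _)).
  have an : (N s w < (n - (N u w - N s w)).+1)%N by rewrite ltnS; lia.
  rewrite (bigD1 (Ordinal bn))//= big1 ?adde0; last first.
    move=> b bneq; rewrite /f big1// => a _.
    rewrite indicE memNset ?mulr0// => -[_ eb _]; case/eqP: bneq.
    by apply/val_inj; rewrite /= -eb.
  rewrite /f (bigD1 (Ordinal an))//= big1 ?adde0; last first.
    move=> a aneq; rewrite indicE memNset ?mulr0// => -[ea _ _]; case/eqP: aneq.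
    by apply/val_inj; rewrite /= -ea /increment (poisson_process0 NP) subn0.
  rewrite indicE mem_set ?mulr1 ?natrB//; split; rewrite // /increment.
    by rewrite (poisson_process0 NP) subn0.
  by rewrite Ntn; lia.
have mA := measurable_level t n.
have mf b a : measurable_fun (level t n) (fun w => (b%:R ^+ 2 * \1_(E b a) w : R)%:E).
  apply/measurable_EFinP; apply: measurable_funM => //.
have f0 (b a : nat) w : (0 <= (b%:R ^+ 2 * \1_(E b a) w : R)%:E)%E.
  by rewrite lee_fin mulr_ge0// exprn_ge0.
rewrite ge0_integral_sum//; last 2 first.
- by move=> b; exact: emeasurable_sum.
- by move=> b w _; exact: sume_ge0.
rewrite -sumEFin; apply: eq_bigr => b _.
rewrite ge0_integral_sum//.
have -> : lambda * (t - (u - s)) = lambda * s + lambda * (t - u) by ring.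
rewrite -poisson_convolution !mulr_sumr -sumEFin; apply: eq_bigr => a _.
under eq_integral do rewrite EFinM.
rewrite ge0_integralZl_EFin//; last first.
  by apply/measurable_EFinP; apply: measurable_funTS; exact: measurable_indic.
rewrite integral_indic// setIidl; last first.
  move=> w [ea eb ec] /=; have := mono s u w s0 su; have := mono u t w u0 ut.
  move: ea eb ec (ltn_ord a) (ltn_ord b); rewrite /increment (poisson_process0 NP); lia.
apply: etrans (congr1 (fun p => (_ * p)%E) (increment3_law s u t a b (n - b - a) s0 su ut)) _.
by rewrite -EFinM; congr EFin; ring.
Qed.

Lemma integral_sq_count (s u t : R) n :
  0 < t -> 0 <= s <= t -> 0 <= u <= t ->
  (\int[P]_(w in level t n) (((N u w)%:R - (N s w)%:R) ^+ 2)%:E =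
   (poisson_weight (lambda * t) n *
    (n%:R * (n%:R - 1) * (u - s) ^+ 2 / t ^+ 2 + n%:R * `|u - s| / t))%:E)%E.
Proof.
move=> t0; wlog su : s u / s <= u => [hw|] /andP[s0 st] /andP[u0 ut].
  have [su|/ltW us] := leP s u; first by rewrite hw ?s0 ?st ?u0 ?ut.
  under eq_integral do rewrite -sqrrN opprB.
  by rewrite hw ?s0 ?st ?u0 ?ut// -sqrrN opprB distrC.
rewrite integral_sq_increment// poisson_moment2; last first.
  by rewrite -mulrDr addrC subrK mulf_neq0 ?gt_eqF.
rewrite -mulrDr [u - s + _]addrC subrK ger0_norm ?subr_ge0//.
by congr EFin; field; rewrite !gt_eqF.
Qed.

Lemma integrable_bounded_level (X : T -> R) (C : R) t n :
  measurable_fun setT X -> (forall w, level t n w -> `|X w| <= C) ->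
  P.-integrable (level t n) (EFin \o X).
Proof.
move=> mX XC; apply: measurable_bounded_integrable.
- exact: measurable_level.
- apply: le_lt_trans (probability_le1 P (measurable_level t n)) _; exact: ltry.
- exact: measurable_funTS.
- exists C; split; first exact: num_real.
  by move=> M CM w Aw; apply: le_trans (XC w Aw) (ltW CM).
Qed.

Lemma integrable_count_product (r s u v t : R) n :
  0 <= r <= t -> 0 <= s <= t -> 0 <= u <= t -> 0 <= v <= t ->
  P.-integrable (level t n) (EFin \o (fun w =>
    ((N s w)%:R - (N r w)%:R) * ((N v w)%:R - (N u w)%:R))).
Proof.
move=> /andP[r0 rt] /andP[s0 st] /andP[u0 ut] /andP[v0 vt].
apply: (@integrable_bounded_level _ (n%:R * n%:R)).
  by apply: measurable_funM; apply: measurable_funB; exact: measurable_count.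
move=> w Aw; rewrite normrM ler_pM//.
  have : (N s w)%:R <= n%:R :> R by rewrite ler_nat (count_le _ t).
  have : (N r w)%:R <= n%:R :> R by rewrite ler_nat (count_le _ t).
  have : 0 <= (N s w)%:R :> R by [].
  have : 0 <= (N r w)%:R :> R by [].
  rewrite ler_norml; lra.
have : (N u w)%:R <= n%:R :> R by rewrite ler_nat (count_le _ t).
have : (N v w)%:R <= n%:R :> R by rewrite ler_nat (count_le _ t).
have : 0 <= (N u w)%:R :> R by [].
have : 0 <= (N v w)%:R :> R by [].
rewrite ler_norml; lra.
Qed.

Lemma integral_lincomb (I : finType) (c : I -> R) (f : I -> T -> R) (v : I -> R)
    (A : set T) : measurable A ->
  (forall i, P.-integrable A (EFin \o f i)) ->
  (forall i, (\int[P]_(w in A) (f i w)%:E = (v i)%:E)%E) ->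
  (\int[P]_(w in A) (\sum_i c i * f i w)%:E = (\sum_i c i * v i)%:E)%E.
Proof.
move=> mA intf vE; under eq_integral do rewrite -sumEFin.
rewrite (@integral_sum _ _ _ _ _ mA _ (fun i w => (c i * f i w)%:E)); last first.
  by move=> i; have := integrableZl mA (c i) (intf i).
rewrite -sumEFin; apply: eq_bigr => i _; under eq_integral do rewrite EFinM.
by rewrite (integralZl mA (intf i)) vE.
Qed.

(** Polarization: [2 (N s - N r) (N v - N u)] is a signed sum of the four squares
    [(N y - N x)^2] with [x] in [{r, s}] and [y] in [{u, v}], each of which is
    given by [integral_sq_count], whatever the order of the four times. *)
Lemma integral_count_product (r s u v t : R) n : 0 < t ->
  0 <= r <= t -> 0 <= s <= t -> 0 <= u <= t -> 0 <= v <= t ->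
  (\int[P]_(w in level t n)
     (((N s w)%:R - (N r w)%:R) * ((N v w)%:R - (N u w)%:R))%:E =
   (poisson_weight (lambda * t) n *
    (n%:R * (n%:R - 1) * ((s - r) * (v - u)) / t ^+ 2 +
     n%:R * ((`|u - s| + `|v - r| - `|u - r| - `|v - s|) / 2) / t))%:E)%E.
Proof.
move=> t0 hr hs hu hv.
pose a (e : bool) := if e then s else r; pose b (e : bool) := if e then v else u.
(* The sign of a square in the polarization formula. *)
pose c (e : bool * bool) : R := if e.1 == e.2 then - 2^-1 else 2^-1.
pose f (e : bool * bool) w : R := ((N (b e.2) w)%:R - (N (a e.1) w)%:R) ^+ 2.
pose m (e : bool * bool) := poisson_weight (lambda * t) n *
  (n%:R * (n%:R - 1) * (b e.2 - a e.1) ^+ 2 / t ^+ 2 + n%:R * `|b e.2 - a e.1| / t).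
have ha e : 0 <= a e <= t by case: e.
have hb e : 0 <= b e <= t by case: e.
transitivity (\int[P]_(w in level t n) (\sum_e c e * f e w)%:E)%E.
  apply: eq_integral => w _; congr EFin.
  rewrite -(pair_bigA _ (fun e1 e2 => c (e1, e2) * f (e1, e2) w))/= !big_bool/=.
  by rewrite /c /f/=; field.
rewrite (integral_lincomb _ c f m).
- congr EFin.
  rewrite -(pair_bigA _ (fun e1 e2 => c (e1, e2) * m (e1, e2)))/= !big_bool/=.
  by rewrite /c /m/=; field; rewrite gt_eqF.
- exact: measurable_level.
- by move=> e; exact: integrable_count_product.
- by move=> e; exact: integral_sq_count.
Qed.

(** For increments over cells of the same grid, the combination of absolute values
    in [integral_count_product] is a second difference of [|x|]: it is [2 h] when
    the two cells coincide and 0 otherwise. *)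
Lemma integral_sq_sum (t : R) (m n : nat) (c : 'I_m.+1 -> R) : 0 < t ->
  let h := t / m.+1%:R in
  (\int[P]_(w in level t n)
    ((\sum_k c k * ((N (k.+1%:R * h) w)%:R - (N (k%:R * h) w)%:R)) ^+ 2)%:E =
   (poisson_weight (lambda * t) n *
    (n%:R * (n%:R - 1) * ((\sum_k c k) / m.+1%:R) ^+ 2 +
     n%:R * ((\sum_k c k ^+ 2) / m.+1%:R)))%:E)%E.
Proof.
move=> t0 h; have h0 : 0 < h by rewrite divr_gt0.
have hE : h = t / m.+1%:R by [].
clearbody h.
have m0 : m.+1%:R != 0 :> R by [].
have ht (k : nat) : (k <= m.+1)%N -> 0 <= k%:R * h <= t.
  move=> km; rewrite mulr_ge0 ?(ltW h0)//= hE mulrCA ger_pMr//.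
  by rewrite ler_pdivrMr ?ltr0n// mul1r ler_nat.
pose f (p : 'I_m.+1 * 'I_m.+1) w : R :=
  ((N (p.1.+1%:R * h) w)%:R - (N (p.1%:R * h) w)%:R) *
  ((N (p.2.+1%:R * h) w)%:R - (N (p.2%:R * h) w)%:R).
pose v (p : 'I_m.+1 * 'I_m.+1) := poisson_weight (lambda * t) n *
  (n%:R * (n%:R - 1) / m.+1%:R ^+ 2 + n%:R * (p.1 == p.2)%:R / m.+1%:R).
transitivity (\int[P]_(w in level t n) (\sum_p c p.1 * c p.2 * f p w)%:E)%E.
  apply: eq_integral => w _; congr EFin.
  rewrite -(pair_bigA _ (fun k l => c k * c l * f (k, l) w))/= expr2 big_distrlr/=.
  apply: eq_bigr => k _; apply: eq_bigr => l _; rewrite /f/=; ring.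
rewrite (integral_lincomb _ (fun p => c p.1 * c p.2) f v).
- congr EFin; rewrite -(pair_bigA _ (fun k l => c k * c l * v (k, l)))/=.
  transitivity (poisson_weight (lambda * t) n *
     (n%:R * (n%:R - 1) / m.+1%:R ^+ 2 * (\sum_k \sum_l c k * c l) +
      n%:R / m.+1%:R * (\sum_k \sum_l c k * c l * (k == l)%:R))).
    rewrite !mulr_sumr -big_split/= mulr_sumr; apply: eq_bigr => k _.
    rewrite !mulr_sumr -big_split/= mulr_sumr; apply: eq_bigr => l _.
    by rewrite /v/=; ring.
  rewrite -big_distrlr/= -expr2.
  have -> : \sum_k \sum_l c k * c l * (k == l)%:R = \sum_k c k ^+ 2.
    apply: eq_bigr => k _; rewrite (bigD1 k)//= eqxx mulr1 big1 ?addr0// => l lk.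
    by rewrite eq_sym (negbTE lk) mulr0.
  by field.
- exact: measurable_level.
- by move=> p; apply: integrable_count_product; apply: ht => //; exact: ltnW.
- move=> [k l]; rewrite /f /= integral_count_product//; [|apply: ht; rewrite // ltnW//..].
  congr EFin; rewrite /v/=; congr (_ * _); congr (_ + _).
    rewrite -!mulrBl -!natrB// !subSnn !mul1r hE; field; by rewrite ?nat1r ?m0 ?gt_eqF.
  rewrite -!mulrBl !normrM (gtr0_norm h0) -!mulrDl -!mulrBl.
  have -> : (`|l%:R - k.+1%:R| + `|l.+1%:R - k%:R| - `|l%:R - k%:R| -
      `|l.+1%:R - k.+1%:R| : R) = (k == l)%:R * 2.
    rewrite -!natr1; have [->|kl] := eqVneq k l.
      have -> : l%:R - (l%:R + 1) = - 1 :> R by ring.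
      have -> : l%:R + 1 - l%:R = 1 :> R by ring.
      by rewrite !subrr normrN1 normr1 normr0 mul1r !subr0 add0r.
    have : (val k < val l)%N || (val l < val k)%N by rewrite -neq_ltn.
    rewrite mul0r; case/orP => lt.
      have lt' : (val k)%:R + 1 <= (val l)%:R :> R by rewrite natr1 ler_nat.
      by rewrite !ger0_norm; lra.
    have lt' : (val l)%:R + 1 <= (val k)%:R :> R by rewrite natr1 ler_nat.
    by rewrite !ler0_norm; lra.
  by rewrite hE; field; rewrite ?nat1r ?m0 ?gt_eqF.
Qed.

End poisson_process.

(** * Pathwise bounds by step functions *)

Section step_approximation.
Context {R : realType}.
Variables (f : R -> R) (x : nat -> R).
Hypotheses (f_nd : forall r v, x 0%N <= r -> r <= v -> f r <= f v)
  (x_nd : forall k, x k <= x k.+1).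

Lemma grid_le j k : (j <= k)%N -> x j <= x k.
Proof. by move=> jk; apply: (@homo_leq R x <=%R) => //; exact: le_trans. Qed.

Lemma increment_ge0 k : 0 <= f (x k.+1) - f (x k).
Proof. by rewrite subr_ge0 f_nd// grid_le. Qed.

Lemma le_step_right s m : x 0%N <= s -> s <= x m ->
  f s - f (x 0%N) <= \sum_(k < m) (f (x k.+1) - f (x k)) * \1_`[x k, +oo[ s.
Proof.
move=> x0s; elim: m => [|m IH] sx.
  have -> : s = x 0%N by apply/le_anti; rewrite sx.
  by rewrite big_ord0 subrr.
rewrite big_ord_recr/=; have [sm|ms] := leP s (x m).
  by apply: le_trans (IH sm) _; rewrite lerDl mulr_ge0// increment_ge0.
rewrite indicE mem_set ?mulr1/= ?in_itv/= ?andbT ?(ltW ms)//.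
have -> : \sum_(k < m) (f (x k.+1) - f (x k)) * \1_`[x k, +oo[ s = f (x m) - f (x 0%N).
  under eq_bigr => k _.
    rewrite indicE mem_set ?mulr1; last first.
      by rewrite /= in_itv/= andbT (le_trans _ (ltW ms))// grid_le// ltnW.
    over.
  by rewrite -(big_mkord predT (fun k => f (x k.+1) - f (x k))) telescope_sumr.
by have := f_nd _ _ x0s sx; lra.
Qed.

Lemma step_left_le s m : x 0%N <= s ->
  \sum_(k < m) (f (x k.+1) - f (x k)) * \1_`[x k.+1, +oo[ s <= f s - f (x 0%N).
Proof.
move=> x0s; elim: m => [|m IH]; first by rewrite big_ord0 subr_ge0 f_nd.
have [ms|sm] := leP (x m.+1) s; last first.
  rewrite big_ord_recr/= indicE memNset ?mulr0 ?addr0//=.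
  by rewrite in_itv/= andbT leNgt sm.
under eq_bigr => k _.
  rewrite indicE mem_set ?mulr1; last first.
    by rewrite /= in_itv/= andbT (le_trans _ ms)// grid_le.
  over.
rewrite -(big_mkord predT (fun k => f (x k.+1) - f (x k))) telescope_sumr//.
by rewrite lerD2r f_nd// grid_le.
Qed.

End step_approximation.

Section fractional_integral_bounds.
Context {R : realType}.
Local Notation mu := (@lebesgue_measure R).
Variables (alpha t : R).
Hypotheses (alpha0 : 0 < alpha).

Lemma measurable_kernel : measurable_fun setT (fun s : R => (t - s) `^ (alpha - 1) : R).
Proof. by apply: (measurableT_comp (measurable_powR _)); exact: measurable_funB. Qed.

Lemma integral_kernel_step (m : nat) (c x : nat -> R) :
  (forall k, 0 <= c k) -> (forall k, (k < m)%N -> 0 <= x k <= t) ->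
  (\int[mu]_(s in `[0%R, t])
     ((t - s) `^ (alpha - 1) * \sum_(k < m) c k * \1_`[x k, +oo[ s)%:E =
   (\sum_(k < m) (t - x k) `^ alpha / alpha * c k)%:E)%E.
Proof.
move=> c0 xt.
under eq_integral do rewrite mulr_sumr -sumEFin.
have mf k : measurable_fun `[0, t]%classic
    (fun s : R => ((t - s) `^ (alpha - 1) * (c k * \1_`[x k, +oo[ s) : R)%:E).
  apply/measurable_EFinP; apply: measurable_funTS.
  apply: measurable_funM; first exact: measurable_kernel.
  by apply: measurable_funM => //; exact: measurable_indic.
rewrite ge0_integral_sum//; last 2 first.
- by move=> k; exact: mf.
- by move=> k s _; rewrite lee_fin !mulr_ge0// powR_ge0.
rewrite -sumEFin; apply: eq_bigr => k _.
have /andP[x0 xkt] := xt k (ltn_ord k).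
under eq_integral do rewrite mulrCA EFinM.
rewrite ge0_integralZl_EFin//; last 2 first.
- by move=> s _; rewrite lee_fin mulr_ge0// powR_ge0.
- apply/measurable_EFinP; apply: measurable_funTS.
  by apply: measurable_funM; [exact: measurable_kernel|exact: measurable_indic].
rewrite mulrC EFinM -(integral_subr_powR _ _ _ alpha0 xkt); congr (_ * _)%E.
have -> : `[x k, t]%classic = `[0, t] `&` `[x k, +oo[.
  apply/seteqP; split => s /=; rewrite !in_itv/= andbT.
    by move=> /andP[xs ->]; rewrite (le_trans x0 xs) xs.
  by move=> [/andP[_ ->] ->].
rewrite integral_mkcondr; apply: eq_integral => s _; rewrite patchE indicE.
by case: ifPn => _; rewrite ?mulr1 ?mulr0.
Qed.

Variable f : R -> R.
Hypotheses (f0 : f 0 = 0) (f_nd : forall r v, 0 <= r -> r <= v -> f r <= f v).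

(** The bounds are in terms of the integrals of the two step functions, computed
    by [integral_kernel_step]. *)
Lemma fractional_integral_bounds (m : nat) : 0 < t ->
  let h := t / m.+1%:R in
  let D k := f (k.+1%:R * h) - f (k%:R * h) in
  0 <= \sum_(k < m.+1) (t - k.+1%:R * h) `^ alpha / alpha * D k /\
  (Gamma alpha)^-1 * \sum_(k < m.+1) (t - k.+1%:R * h) `^ alpha / alpha * D k
   <= fractional_integral alpha f t
   <= (Gamma alpha)^-1 * \sum_(k < m.+1) (t - k%:R * h) `^ alpha / alpha * D k.
Proof.
move=> t0 h D; have h0 : 0 < h by rewrite divr_gt0.
pose x k := k%:R * h.
have x00 : x 0%N = 0 by rewrite /x mul0r.
have xm : x m.+1 = t by rewrite /x /h mulrC divfK.
have x_nd k : x k <= x k.+1 by rewrite ler_wpM2r ?(ltW h0)// ler_nat.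
have f_nd' r v : x 0%N <= r -> r <= v -> f r <= f v by rewrite x00; exact: f_nd.
have xt k : (k <= m.+1)%N -> 0 <= x k <= t.
  by move=> km; rewrite -xm -x00 !grid_le.
have D0 k : 0 <= D k by exact: (increment_ge0 f x).
have fge0 s : 0 <= s -> 0 <= f s by move=> s0; rewrite -f0 f_nd.
split; first by apply: sumr_ge0 => k _; rewrite mulr_ge0// divr_ge0 ?powR_ge0 ?ltW.
have Lo : ((\sum_(k < m.+1) (t - k.+1%:R * h) `^ alpha / alpha * D k)%:E <=
    \int[mu]_(s in `[0%R, t]) ((t - s) `^ (alpha - 1) * f s)%:E)%E.
  rewrite -(integral_kernel_step _ D (fun k => x k.+1))//; last by move=> k; exact: xt.
  apply: le_integral_ge0 => s; rewrite /= in_itv/= => /andP[s0 st].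
    by rewrite lee_fin mulr_ge0 ?powR_ge0// sumr_ge0// => k _; rewrite mulr_ge0.
  rewrite lee_fin ler_wpM2l ?powR_ge0//.
  have := step_left_le f x f_nd' x_nd s m.+1; rewrite x00 f0 subr0; exact.
have Up : (\int[mu]_(s in `[0%R, t]) ((t - s) `^ (alpha - 1) * f s)%:E <=
    (\sum_(k < m.+1) (t - k%:R * h) `^ alpha / alpha * D k)%:E)%E.
  rewrite -(integral_kernel_step _ D x)//; last by move=> k km; apply: xt; exact: ltnW.
  apply: le_integral_ge0 => s; rewrite /= in_itv/= => /andP[s0 st].
    by rewrite lee_fin mulr_ge0 ?powR_ge0// fge0.
  rewrite lee_fin ler_wpM2l ?powR_ge0//.
  have := le_step_right f x f_nd' x_nd s m.+1; rewrite x00 xm f0 subr0; exact.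
have iG : 0 < (Gamma alpha)^-1 by rewrite invr_gt0 Gamma_gt0.
rewrite /fractional_integral /Rintegral !ler_pM2l//.
by move: Lo Up; case: integral => [r| |]//; rewrite !lee_fin => -> ->.
Qed.

End fractional_integral_bounds.

(** * Refinement of the grid *)

Section mesh_limit.
Context {R : realType}.
Variables (alpha t kappa : R) (n : nat).
Hypotheses (alpha0 : 0 < alpha) (t0 : 0 < t).

(** The conditional second moment of [\sum_k c k * D k], by [integral_sq_sum]. *)
Definition grid_moment (c : nat -> R) (m : nat) : R :=
  n%:R * (n%:R - 1) * ((\sum_(k < m.+1) c k) / m.+1%:R) ^+ 2 +
  n%:R * ((\sum_(k < m.+1) c k ^+ 2) / m.+1%:R).

Let limit_moment : R := n%:R * (n%:R - 1) * (kappa * (t `^ alpha / alpha) * (alpha + 1)^-1) ^+ 2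
  + n%:R * ((kappa * (t `^ alpha / alpha)) ^+ 2 * (2 * alpha + 1)^-1).

Lemma grid_powR (c : R) (k m : nat) : (k <= m.+1)%N ->
  (t - k%:R * (t / m.+1%:R)) `^ c = t `^ c * (1 - k%:R / m.+1%:R) `^ c.
Proof.
move=> km; rewrite -powRM ?(ltW t0)//; first by congr (_ `^ _); ring.
by rewrite subr_ge0 ler_pdivrMr ?ltr0n// mul1r ler_nat.
Qed.

Lemma sqr_powR (y : R) : (y `^ alpha) ^+ 2 = y `^ (2 * alpha).
Proof. by rewrite -powR_mulrn ?powR_ge0// -powRrM mulrC. Qed.

(** Common part of the two limits: [y m k] are the sampling points in the
    variable [1 - s / t], and [M b m] is the corresponding mean of the power [b],
    used at the exponents [alpha] and [2 alpha]. *)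
Lemma cvg_grid_moment (M : R -> nat -> R) (y : nat -> nat -> R) :
  (forall b m, M b m = (\sum_(k < m.+1) y m k `^ b) / m.+1%:R) ->
  (forall b, 0 < b -> M b m @[m --> \oo] --> (b + 1)^-1) ->
  grid_moment (fun k => kappa * (t `^ alpha * y m k `^ alpha / alpha)) m
    @[m --> \oo] --> limit_moment.
Proof.
move=> ME Mcvg.
have a20 : 0 < 2 * alpha by rewrite mulr_gt0.
have -> : (fun m => grid_moment (fun k => kappa * (t `^ alpha * y m k `^ alpha / alpha)) m) =
  (fun m => n%:R * (n%:R - 1) * (kappa * (t `^ alpha / alpha) * M alpha m) ^+ 2 +
    n%:R * ((kappa * (t `^ alpha / alpha)) ^+ 2 * M (2 * alpha) m)).
  apply/funext => m; rewrite /grid_moment !ME; congr (_ * _ ^+ 2 + _ * _).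
    rewrite mulrA mulr_sumr; congr (_ / _); apply: eq_bigr => k _; ring.
  rewrite mulrA mulr_sumr; congr (_ / _); apply: eq_bigr => k _.
  by rewrite -sqr_powR; ring.
apply: cvgD; apply: cvgM; try exact: cvg_cst.
  by apply: cvgM; (apply: cvgM; [exact: cvg_cst|exact: Mcvg]).
by apply: cvgM; [exact: cvg_cst|exact: Mcvg].
Qed.

Lemma cvg_grid_moment_right :
  grid_moment (fun k => kappa * ((t - k%:R * (t / m.+1%:R)) `^ alpha / alpha)) m
    @[m --> \oo] --> limit_moment.
Proof.
have := @cvg_grid_moment mean_powR_right (fun m k => 1 - k%:R / m.+1%:R) (fun _ _ => erefl)
  (@cvg_mean_powR_right R).
apply: cvg_trans; apply: near_eq_cvg; apply: nearW => m.
by rewrite /grid_moment; congr (_ * (_ / _) ^+ 2 + _ * (_ / _)); apply: eq_bigr => k _;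
  rewrite grid_powR// ltnW.
Qed.

Lemma cvg_grid_moment_left :
  grid_moment (fun k => kappa * ((t - k.+1%:R * (t / m.+1%:R)) `^ alpha / alpha)) m
    @[m --> \oo] --> limit_moment.
Proof.
have := @cvg_grid_moment mean_powR_left (fun m k => 1 - k.+1%:R / m.+1%:R) (fun _ _ => erefl)
  (@cvg_mean_powR_left R).
apply: cvg_trans; apply: near_eq_cvg; apply: nearW => m.
by rewrite /grid_moment; congr (_ * (_ / _) ^+ 2 + _ * (_ / _)); apply: eq_bigr => k _;
  rewrite grid_powR.
Qed.

End mesh_limit.

(** * The conditional second moment *)

Theorem mainTheorem4 (d : measure_display) (T : measurableType d)
    (R : realType) (P : probability T R) (lambda alpha : R)
    (N : R -> {RV P >-> nat}) :
  0 < lambda -> 0 < alpha -> is_poisson_process lambda N ->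
  forall (t : R) (n : nat), 0 < t ->
  cond_expectation P
    (fun w => fractional_integral alpha (fun s => (N s w)%:R) t ^+ 2)
    [set w | N t w = n] =
  (2 * n%:R * t `^ (2 * alpha) * Gamma (2 * alpha)
     / (alpha * Gamma alpha ^+ 2 * Gamma (2 * alpha + 2))
   + n%:R * (n%:R - 1) * t `^ (2 * alpha) / Gamma (alpha + 2) ^+ 2)%:E.
Proof.
move=> lambda0 alpha0 NP t n t0.
set X := fun w => fractional_integral alpha (fun s => (N s w)%:R) t.
set A := [set w | N t w = n]; set q := poisson_weight (lambda * t) n.
have q0 : 0 < q by apply: poisson_weight_gt0; rewrite mulr_gt0.
set kappa := (Gamma alpha)^-1.
have kappa0 : 0 < kappa by rewrite invr_gt0 Gamma_gt0.
have N00 w : (N 0 w)%:R = 0 :> R by rewrite (poisson_process0 NP).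
have N_nd w (r v : R) : 0 <= r -> r <= v -> (N r w)%:R <= (N v w)%:R :> R.
  by move=> r0 rv; rewrite ler_nat; exact: poisson_process_nondecreasing NP _ _ _ r0 rv.
have bnd w m := fractional_integral_bounds alpha t alpha0 (fun s => (N s w)%:R)
  (N00 w) (N_nd w) m t0.
have XE w : X w = fractional_integral alpha (fun s => (N s w)%:R) t by [].
have lo m : ((q * grid_moment n
    (fun k => kappa * ((t - k.+1%:R * (t / m.+1%:R)) `^ alpha / alpha)) m)%:E <=
    \int[P]_(w in A) (X w ^+ 2)%:E)%E.
  have <- := integral_sq_sum P lambda N lambda0 NP t m n
    (fun k : 'I_m.+1 => kappa * ((t - k.+1%:R * (t / m.+1%:R)) `^ alpha / alpha)) t0.
  apply: le_integral_ge0 => w _; first by rewrite lee_fin sqr_ge0.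
  have [s0 /andP[hl _]] := bnd w m.
  under eq_bigr do rewrite -mulrA.
  rewrite -mulr_sumr lee_fin ler_pXn2r ?nnegrE// ?XE.
    by rewrite mulr_ge0 ?(ltW kappa0).
  by apply: le_trans hl; rewrite mulr_ge0 ?(ltW kappa0).
have up m : (\int[P]_(w in A) (X w ^+ 2)%:E <= (q * grid_moment n
    (fun k => kappa * ((t - k%:R * (t / m.+1%:R)) `^ alpha / alpha)) m)%:E)%E.
  have <- := integral_sq_sum P lambda N lambda0 NP t m n
    (fun k : 'I_m.+1 => kappa * ((t - k%:R * (t / m.+1%:R)) `^ alpha / alpha)) t0.
  apply: le_integral_ge0 => w _; first by rewrite lee_fin sqr_ge0.
  have [s0 /andP[hl hr]] := bnd w m.
  have X0 : 0 <= X w by apply: le_trans hl; rewrite mulr_ge0 ?(ltW kappa0).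
  under eq_bigr do rewrite -mulrA.
  rewrite -mulr_sumr lee_fin ler_pXn2r ?nnegrE// ?XE.
  by apply: le_trans hr.
have cvg_loup (u : nat -> R) (l : R) : u m @[m --> \oo] --> l ->
    (q * u m)%:E @[m --> \oo] --> (q * l)%:E.
  move=> ul; apply: cvg_EFin; first exact: nearW.
  by apply: cvgM; [exact: cvg_cst|exact: ul].
have clo := cvg_loup _ _ (cvg_grid_moment_left alpha t kappa n alpha0 t0).
have cup := cvg_loup _ _ (cvg_grid_moment_right alpha t kappa n alpha0 t0).
have sandwich : \forall m \near \oo, ((q * grid_moment n
    (fun k => kappa * ((t - k.+1%:R * (t / m.+1%:R)) `^ alpha / alpha)) m)%:E <=
    cst (\int[P]_(w in A) (X w ^+ 2)%:E) m <= (q * grid_moment n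
    (fun k => kappa * ((t - k%:R * (t / m.+1%:R)) `^ alpha / alpha)) m)%:E)%E.
  by apply: nearW => m; rewrite lo up.
have cX : cst (\int[P]_(w in A) (X w ^+ 2)%:E)%E m @[m --> \oo] --> _ :=
  squeeze_cvge sandwich clo cup.
have /(_ _ _ _) eX := @cvg_unique _ (@ereal_hausdorff R) _ _ _ _ (cvg_cst _) (cX _).
have EA : ('E_P[((fun w => X w ^+ 2) \* \1_A)%R] = \int[P]_(w in A) (X w ^+ 2)%:E)%E.
  rewrite unlock [RHS]integral_mkcond; apply: eq_integral => w _.
  by rewrite patchE /= indicE; case: ifPn => _; rewrite ?mulr1 ?mulr0.
rewrite /cond_expectation EA eX (poisson_process_law P lambda N lambda0 NP t n (ltW t0)).
rewrite inver gt_eqF// -EFinM; congr EFin.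
have a20 : 0 < 2 * alpha by rewrite mulr_gt0.
have -> : alpha + 2 = alpha + 1 + 1 by rewrite -addrA.
have -> : 2 * alpha + 2 = 2 * alpha + 1 + 1 by rewrite -addrA.
rewrite !Gamma_rec ?addr_gt0//.
have G1 := Gamma_gt0 _ alpha0; have G2 := Gamma_gt0 _ a20.
rewrite -/q -sqr_powR /kappa; clearbody q; field.
by rewrite !gt_eqF// ?addr_gt0.
Qed.
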